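(* Let $\mathcal{A}$ be a real symmetric positive definite tensor of order $m$ and dimension $n$, let $d = n(m-1)^{n-1} \ge 2$, and let $\lambda_1 \ge \lambda_2 \ge \cdots \ge \lambda_d > 0$ be its H-spectrum (assumed real). Let $T = \sum_{i=1}^d \lambda_i = (m-1)^{n-1}\operatorname{tr}(\mathcal{A})$ and $D = \prod_{i=1}^d \lambda_i = \det(\mathcal{A})$. Define the polynomial $$\phi_{T,D}(\Lambda) := \Lambda (T - \Lambda)^{d-1} - D (d-1)^{d-1}.$$ Then, in the interval $(0,T)$, $\phi_{T,D}$ has either a unique double root at $\Lambda = T/d$ (this is the case $D = (T/d)^d$), or exactly two simple real roots $\Lambda^-, \Lambda^+$ with $0 < \Lambda^- < T/d < \Lambda^+ < T$. In the latter case, $$B_2^+(T, D) = \Lambda^+, \qquad B_2^-(T, D) = \Lambda^-,$$ that is, $\Lambda^+$ is the sharp upper bound on $\lambda_{\max}$ and $\Lambda^-$ is the sharp lower bound on $\lambda_{\min}$ given $T$ and $D$. These bounds are attained on the spectra $(\Lambda^+, c, \ldots, c)$ and $(c', \ldots, c', \Lambda^-)$ respectively (with $d-1$ copies of $c$, resp. $c'$), where $c = (T - \Lambda^+)/(d-1)$ and $c' = (T - \Lambda^-)/(d-1)$.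
   Context: A real tensor $\mathcal{A} = (a_{i_1\cdots i_m})$, $1 \le i_j \le n$, is symmetric if its entries are invariant under permutations of the indices; it is positive definite if $\mathcal{A}x^m = \sum a_{i_1\cdots i_m}x_{i_1}\cdots x_{i_m} > 0$ for all $x \in \mathbb{R}^n\setminus\{0\}$ (so $m$ is even). An H-eigenvalue is a scalar $\lambda$ with $\mathcal{A}x^{m-1} = \lambda x^{[m-1]}$ for some $x \neq 0$, where $(\mathcal{A}x^{m-1})_i = \sum_{i_2,\ldots,i_m} a_{i i_2\cdots i_m}x_{i_2}\cdots x_{i_m}$ and $x^{[m-1]} = (x_1^{m-1},\ldots,x_n^{m-1})^T$. Counted with algebraic multiplicity there are $d = n(m-1)^{n-1}$ eigenvalues; the standing assumption is that all of them are real and positive, $\lambda_1 \ge \cdots \ge \lambda_d > 0$; $\lambda_{\max} = \lambda_1$, $\lambda_{\min} = \lambda_d$. Here $\operatorname{tr}(\mathcal{A}) = \sum_i a_{i\cdots i}$ and $\det(\mathcal{A})$ is the resultant of the system $\mathcal{A}x^{m-1}=0$; it is known that $\sum\lambda_i = (m-1)^{n-1}\operatorname{tr}(\mathcal{A})$ and $\prod\lambda_i = \det(\mathcal{A})$. The two-invariant feasibility region is $\mathcal{F}_2(T;D) = \{\lambda \in \mathbb{R}^d_{>0} : \sum_i \lambda_i = T,\ \prod_i \lambda_i = D\}$, and $B_2^+(T,D) = \max\{\lambda_1 : \lambda \in \mathcal{F}_2(T;D)\}$, $B_2^-(T,D) = \min\{\lambda_d : \lambda \in \mathcal{F}_2(T;D)\}$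 (coordinates of points of $\mathcal{F}_2$ are not required to be ordered). *)

(* Defs.v *)
From HB Require Import structures.
From mathcomp Require Import all_boot all_order all_algebra.
From mathcomp Require Import complex reals mpoly.

Set Implicit Arguments.
Unset Strict Implicit.
Unset Printing Implicit Defensive.

Import Order.TTheory GRing.Theory Num.Theory.
Local Open Scope ring_scope.
Local Open Scope complex_scope.

(** * Tensors of order [m] and dimension [n] *)

Definition tensor (S : Type) (m n : nat) := m.-tuple 'I_n -> S.

Section Tensor.
Variables (S : comNzRingType) (m n : nat).
Implicit Type A : tensor S m n.

Definition tensor_symmetric A :=
  forall s t : m.-tuple 'I_n, perm_eq s t -> A s = A t.

(* A x^m *)
Definition tensor_form A (x : 'rV[S]_n) : S :=
  \sum_(t : m.-tuple 'I_n) A t * \prod_(j <- t) x 0 j.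

(* The i-th component of A x^(m-1), as a polynomial in x: the tuples t
   with head i are the indices (i, i_2, .., i_m). *)
Definition tensor_sys A (i : 'I_n) : {mpoly S[n]} :=
  \sum_(t : m.-tuple 'I_n | ohead t == Some i)
     A t *: \prod_(j <- behead t) 'X_j.

Definition tensor_trace A : S := \sum_(i < n) A (nseq_tuple m i).

Definition tensor_id : tensor S m n := fun t => (constant t)%:R.

End Tensor.

Arguments tensor_id S {m n} t.

Definition tensor_posdef (R : realType) (m n : nat) (A : tensor R m n) :=
  forall x : 'rV[R]_n, x != 0 -> 0 < tensor_form A x.

(** * The resultant of n forms of degree k in n variables *)

(* The pair (i, a) indexes the coefficient of the monomial a, of degree k,
   in the i-th form. *)
Definition rcoef (n k : nat) : finType :=
  ('I_n * {a : 'X_{1..n < k.+1} | mdeg a == k})%type.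

Definition res_poly (n k : nat) := {mpoly int[#|rcoef n k|]}.

Definition res_eval (n k : nat) (P : res_poly n k) (S : comNzRingType)
    (f : 'I_n -> {mpoly S[n]}) : S :=
  mmap intr
    (fun c => let v := enum_val c in (f v.1)@_(bmnm (val v.2))) P.

(* The classical characterization of the resultant: the irreducible integer
   polynomial in the coefficients of n generic forms of degree k which is
   homogeneous of degree k ^ (n - 1) in the coefficients of each form,
   vanishes exactly when the forms have a common nonzero complex zero, and is
   1 at (x_1 ^ k, .., x_n ^ k). At most one P satisfies it. *)
Definition is_resultant (R : realType) (n k : nat) (P : res_poly n k) : Prop :=
  [/\ (P != 0 /\ P \isn't a GRing.unit) /\
        (forall p q : res_poly n k, P = p * q ->
           p \is a GRing.unit \/ q \is a GRing.unit),
      forall (f : 'I_n -> {mpoly R[i][n]}) (i : 'I_n) (c : R[i]),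
        (forall j, f j \is k.-homog) ->
        res_eval P (fun j => if j == i then c *: f j else f j)
          = c ^+ (k ^ n.-1) * res_eval P f,
      forall f : 'I_n -> {mpoly R[i][n]}, (forall j, f j \is k.-homog) ->
        (res_eval P f = 0 <->
         exists2 x : 'rV[R[i]]_n, x != 0 & forall j, (f j).@[x 0] = 0)
    & res_eval P (fun j => 'X_j ^+ k : {mpoly R[i][n]}) = 1 ].

(** * Determinant, eigenvalues and spectrum of a tensor *)

Definition tensor_det (m n : nat) (Res : res_poly n m.-1) (S : comNzRingType)
    (A : tensor S m n) : S :=
  res_eval Res (tensor_sys A).

(* det(X * I - A) *)
Definition tensor_char_poly (m n : nat) (Res : res_poly n m.-1)
    (S : comNzRingType) (A : tensor S m n) : {poly S} :=
  tensor_det Res (fun t => tensor_id _ t * 'X - (A t)%:P).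

(* A x^(m-1) = l x^[m-1] for some nonzero complex x *)
Definition H_eigenvalue (R : realType) (m n : nat) (A : tensor R m n)
    (l : R) : Prop :=
  exists2 x : 'rV[R[i]]_n, x != 0 &
    forall i, (tensor_sys (fun t => (A t)%:C) i).@[x 0]
              = l%:C * x 0 i ^+ m.-1.

(* The eigenvalues counted with algebraic multiplicity are all real, and
   s lists them in decreasing order. *)
Definition is_H_spectrum (R : realType) (m n : nat) (Res : res_poly n m.-1)
    (A : tensor R m n) (s : seq R) : Prop :=
  [/\ size s = (n * m.-1 ^ n.-1)%N,
      tensor_char_poly Res A = \prod_(l <- s) ('X - l%:P)
    & sorted >=%R s ].

(** * Feasibility region and extremal values *)

Section Feasible.
Variable R : realType.

Definition feasible2 (d : nat) (T D : R) (s : seq R) : Prop :=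
  [/\ size s = d, {in s, forall l, 0 < l},
      \sum_(l <- s) l = T & \prod_(l <- s) l = D ].

(* b is the maximum of the first coordinate over the feasibility region *)
Definition is_B2plus (d : nat) (T D b : R) : Prop :=
  (exists2 s, feasible2 d T D s & head 0 s = b) /\
  (forall s, feasible2 d T D s -> head 0 s <= b).

(* b is the minimum of the last coordinate over the feasibility region *)
Definition is_B2minus (d : nat) (T D b : R) : Prop :=
  (exists2 s, feasible2 d T D s & last 0 s = b) /\
  (forall s, feasible2 d T D s -> b <= last 0 s).

Definition phi (d : nat) (T D : R) : {poly R} :=
  'X * (T%:P - 'X) ^+ d.-1 - (D * d.-1%:R ^+ d.-1)%:P.

End Feasible.

(** The eigenvalues are the roots of the characteristic polynomial. *)

Lemma res_eval_morph (n k : nat) (P : res_poly n k) (S S' : comNzRingType)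
    (h : {rmorphism S -> S'}) (f : 'I_n -> {mpoly S[n]})
    (g : 'I_n -> {mpoly S'[n]}) :
  (forall i a, (g i)@_a = h (f i)@_a) -> res_eval P g = h (res_eval P f).
Proof.
move=> gf; rewrite /res_eval /mmap rmorph_sum; apply: eq_bigr => a _.
rewrite rmorphM rmorph_int rmorph_prod; congr (_ * _).
by apply: eq_bigr => c _; rewrite rmorphXn gf.
Qed.

Lemma tensor_sys_morph (m n : nat) (S S' : comNzRingType)
    (h : {rmorphism S -> S'}) (A : tensor S m n) (B : tensor S' m n) i a :
  (forall t, B t = h (A t)) -> (tensor_sys B i)@_a = h (tensor_sys A i)@_a.
Proof.
move=> BA; rewrite /tensor_sys !raddf_sum /=; apply: eq_bigr => t _.
rewrite !mcoeffZ rmorphM BA -mcoeff_map_mpoly rmorph_prod /=; congr (_ * _@_a).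
by apply: eq_bigr => j _; rewrite map_mpolyX.
Qed.

Lemma tensor_sys_homog (m n : nat) (S : comNzRingType) (A : tensor S m n) i :
  tensor_sys A i \is m.-1.-homog.
Proof.
apply: rpred_sum => t _; apply: rpredZ.
have -> : m.-1 = size (behead t) by rewrite size_behead size_tuple.
elim: (behead t) => [|j s ih] /=; first by rewrite big_nil dhomog1.
rewrite big_cons -add1n; apply: dhomogM ih.
by rewrite dhomogX /= mdeg1.
Qed.

Lemma tensor_sys_id (m n : nat) (S : comNzRingType) (i : 'I_n) : (0 < m)%N ->
  tensor_sys (tensor_id S : tensor S m n) i = 'X_i ^+ m.-1.
Proof.
move=> m0; rewrite /tensor_sys (bigD1 (nseq_tuple m i)) /=; last first.
  by case: m m0.
rewrite [X in _ + X]big1 ?addr0 => [|t /andP[/eqP ti ne]].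
  rewrite /tensor_id (_ : constant _) ?scale1r; last by rewrite constant_nseq.
  case: m m0 => //= m _.
  by elim: m => [|m ih] /=; rewrite ?big_nil // big_cons ih exprS.
rewrite /tensor_id; case: constantP; last by rewrite scale0r.
  exact: i.
case=> y ty; case/eqP: ne; apply: val_inj => /=; move: ti.
rewrite ty size_tuple; case: m m0 t ty => //= m _ t _ [->] //.
Qed.

Lemma H_eigenvalueP (R : realType) (m n : nat) (Res : res_poly n m.-1)
    (A : tensor R m n) (l : R) : (0 < m)%N -> is_resultant R Res ->
  root (tensor_char_poly Res A) l <-> H_eigenvalue A l.
Proof.
move=> m0 [_ _ zeroP _].
pose B : tensor R[i] m n := fun t => tensor_id _ t * l%:C - (A t)%:C.
have sysB i : tensor_sys B i =
    l%:C *: 'X_i ^+ m.-1 - tensor_sys (fun t => (A t)%:C) i.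
  rewrite -(tensor_sys_id _ _ m0) /tensor_sys scaler_sumr -sumrB.
  by apply: eq_bigr => t _; rewrite scalerA -scalerBl [_%:C * _]mulrC.
have -> : root (tensor_char_poly Res A) l <-> tensor_det Res B = 0.
  have -> : tensor_det Res B = (tensor_char_poly Res A).[l]%:C.
    apply: (res_eval_morph _ (h := real_complex R \o horner_eval l)) => i a.
    apply: (tensor_sys_morph (h := real_complex R \o horner_eval l)) => t /=.
    rewrite /horner_eval !hornerE /B /tensor_id -!polyC_natr !hornerE.
    by rewrite rmorphB rmorphM rmorph_nat.
  by split=> [/rootP ->|/complexI/rootP].
rewrite /tensor_det zeroP; last by move=> j; apply: tensor_sys_homog.
split=> -[x x0 xP]; exists x => // i.
  move: (xP i); rewrite sysB mevalB mevalZ rmorphXn /= mevalXU => /eqP.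
  by rewrite subr_eq0 => /eqP.
by rewrite sysB mevalB mevalZ rmorphXn /= mevalXU xP subrr.
Qed.

(* Main.v *)
Require Import Defs.
From mathcomp Require Import all_boot all_order all_algebra.
From mathcomp Require Import complex reals mpoly.
From mathcomp Require Import polyrcf ring.

(** Homogeneity of the resultant gives [det(-A) = (-1)^d det(A)], hence the
    product of the eigenvalues. It also turns the characteristic polynomial
    into the resultant of [x_j^k - t (A x^k)_j], with [k = m - 1], which is
    [\prod_l (1 - t l)]; so the sum of the eigenvalues is minus its derivative
    at [t = 0], i.e. a first order variation of the resultant at
    [(x_1^k, .., x_n^k)]. Perturbing the i-th form by [x_i^k] multiplies the
    resultant by [(1 + t) ^ (k ^ (n - 1))]; perturbing it by another monomial
    creates no nonzero common zero, so the resultant, a polynomial in [t]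
    without complex root, stays constant. Only the diagonal entries of [A]
    contribute, and with weight [k ^ (n - 1)].

    If [x] is a coordinate of a feasible point, AM-GM on the other coordinates
    says [phi(x) >= 0]. As [phi' = (T - x)^(d-2) (T - d x)], Rolle's theorem
    allows at most one root of [phi] on each side of [T / d], and the
    intermediate value theorem finds them and confines the feasible
    coordinates between them. *)

Set Implicit Arguments.
Unset Strict Implicit.

Import Order.TTheory GRing.Theory Num.Theory.
Local Open Scope ring_scope.
Local Open Scope complex_scope.

(** * The trace and the determinant from the resultant *)

Lemma deriv_mmap_intr (S : comNzRingType) (N : nat) (h : 'I_N -> {poly S})
    (p : {mpoly int[N]}) :
  (mmap intr h p)^`() = \sum_i mmap intr h p^`M(i) * (h i)^`().
Proof.
(* The polynomials obeying the chain rule are closed under sum and product and contain constants and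
   variables, hence are all polynomials. *)
pose chain q := (mmap intr h q)^`() = \sum_i mmap intr h q^`M(i) * (h i)^`().
have chainC c : chain c%:MP.
  rewrite /chain mmapC big1 => [|i _]; last by rewrite mderivC mmap0 mul0r.
  by rewrite /= -(rmorph_int polyC) derivC.
have chainD q r : chain q -> chain r -> chain (q + r).
  rewrite /chain => qE rE; rewrite mmapD derivD qE rE -big_split.
  by apply: eq_bigr => i _; rewrite mderivD mmapD mulrDl.
have chainM q r : chain q -> chain r -> chain (q * r).
  rewrite /chain => qE rE; rewrite rmorphM derivM qE rE mulr_suml mulr_sumr.
  rewrite -big_split; apply: eq_bigr => i _.
  by rewrite mderivM mmapD !rmorphM mulrDl /=; ring.
have chainX i : chain 'X_i.
  rewrite /chain mmapX mmap1U (bigD1 i) //= big1 => [|j ji].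
    have -> : 'X_i^`M(i) = 1 :> {mpoly int[N]}.
      rewrite mderivX mnm1E eqxx scale1r -mpolyX0; congr 'X_[_].
      by apply/mnmP => j; rewrite !mnmE subnn.
    by rewrite rmorph1 mul1r addr0.
  by rewrite mderivX mnm1E eq_sym (negPf ji) scale0r mmap0 mul0r.
rewrite -/(chain p) [p]mpolyE; apply: (big_ind chain) => // [|a _].
  by rewrite -[0]mpolyC0.
rewrite -mul_mpolyC mpolyXE_id; apply: (chainM) => //; apply: (big_ind chain) => //.
  by rewrite -[1]mpolyC1.
move=> i _; elim: (a i) => [|k ih]; first by rewrite expr0 -[1]mpolyC1.
by rewrite exprS; apply: (chainM).
Qed.

Lemma horner_mmap_intr (S : comNzRingType) (N : nat) (h : 'I_N -> {poly S})
    (p : {mpoly int[N]}) (x : S) :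
  (mmap intr h p).[x] = mmap intr (fun c => (h c).[x]) p.
Proof.
rewrite /mmap horner_sum; apply: eq_bigr => a _.
rewrite hornerM -(rmorph_int polyC) hornerC horner_prod; congr (_ * _).
by apply: eq_bigr => c _; rewrite horner_exp.
Qed.

Lemma horner_deriv_mmap_intr (S : comNzRingType) (N : nat)
    (h : 'I_N -> {poly S}) (p : {mpoly int[N]}) (x : S) :
  (mmap intr h p)^`().[x] =
  \sum_i mmap intr (fun c => (h c).[x]) p^`M(i) * (h i)^`().[x].
Proof.
rewrite deriv_mmap_intr horner_sum; apply: eq_bigr => i _.
by rewrite hornerM horner_mmap_intr.
Qed.

Lemma eq_res_eval (n k : nat) (P : res_poly n k) (S : comNzRingType)
    (f g : 'I_n -> {mpoly S[n]}) : f =1 g -> res_eval P f = res_eval P g.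
Proof.
by move=> fg; apply: (res_eval_morph _ (h := idfun)) => i a; rewrite /= fg.
Qed.

(** A nonzero polynomial over a closed field has a non-root; this is applied to the difference. *)
Lemma closed_poly_eq (F : closedFieldType) (p q : {poly F}) :
  (forall x, p.[x] = q.[x]) -> p = q.
Proof.
move=> pq; apply/eqP; rewrite -subr_eq0; apply/negPn/negP.
by move/closed_nonrootP => [x]; rewrite /root hornerD hornerN pq subrr eqxx.
Qed.

Lemma XnU_homog (S : nzRingType) (n k : nat) (j : 'I_n) :
  ('X_j ^+ k : {mpoly S[n]}) \is k.-homog.
Proof. by rewrite mpolyXn dhomogX /= mdegMn mdeg1 mul1n. Qed.

(** * Variation of the resultant along a line through the pure powers *)

Section Resultant.
Variables (R : realType) (n k : nat) (P : res_poly n k).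
Hypothesis PP : is_resultant R P.
Local Notation C := R[i].
Implicit Types f g : 'I_n -> {mpoly C[n]}.

Lemma res_scale f c : (forall j, f j \is k.-homog) ->
  res_eval P (fun j => c *: f j) = c ^+ (n * k ^ n.-1) * res_eval P f.
Proof.
case: PP => _ scaleP _ _ fk.
(* The forms are scaled one at a time, [r] listing those already done; each contributes a factor
   [c ^+ (k ^ n.-1)]. *)
have main (r : seq 'I_n) : uniq r ->
    res_eval P (fun j => if j \in r then c *: f j else f j) =
    c ^+ (size r * k ^ n.-1) * res_eval P f.
  elim: r => [_|i r ih /= /andP[ir ur]]; first by rewrite mul0n mul1r.
  rewrite mulSn exprD -mulrA -ih // -(scaleP _ i); last first.
    by move=> j; case: ifP => // _; apply: rpredZ.
  apply: eq_res_eval => j; rewrite inE; case: eqP => [->|//] /=.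
  by rewrite (negPf ir).
have := main (enum 'I_n) (enum_uniq _); rewrite size_enum_ord => <-.
by apply: eq_res_eval => j; rewrite mem_enum.
Qed.

(** The line parameter is the variable of [{poly C}], so that the resultant along the line can be
    differentiated formally and searched for roots. *)
Definition res_line g : {poly C} :=
  res_eval P (fun j => 'X_j ^+ k + 'X *: map_mpoly polyC (g j)).

Lemma eq_res_line g g' : g =1 g' -> res_line g = res_line g'.
Proof. by move=> gg'; apply: eq_res_eval => j; rewrite gg'. Qed.

Lemma horner_res_line g t :
  (res_line g).[t] = res_eval P (fun j => 'X_j ^+ k + t *: g j).
Proof.
apply/esym/(res_eval_morph _ (h := horner_eval t)) => i a.
rewrite !mcoeffD !mcoeffZ mcoeff_map_mpoly rmorphD rmorphM /= !mcoeffXn.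
by rewrite /horner_eval hornerX hornerC -polyC_natr hornerC.
Qed.

(* The partial derivatives of the resultant at the powers ['X_j ^+ k]. *)
Definition res_partial (c : 'I_#|rcoef n k|) : C :=
  mmap intr (fun c => ('X_(enum_val c).1 ^+ k)@_(bmnm (val (enum_val c).2)))
    P^`M(c).

Lemma deriv_res_line0 g :
  (res_line g)^`().[0] =
  \sum_c res_partial c * (g (enum_val c).1)@_(bmnm (val (enum_val c).2)).
Proof.
etransitivity; first exact: horner_deriv_mmap_intr.
apply: eq_bigr => c _; congr (_ * _).
  rewrite /mmap; apply: eq_bigr => a _; congr (_ * _); apply: eq_bigr => l _.
  congr (_ ^+ _); rewrite mcoeffD mcoeffZ mcoeff_map_mpoly !mcoeffXn.
  by rewrite hornerD hornerM hornerX mul0r addr0 -polyC_natr hornerC.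
cbv beta zeta; rewrite mcoeffD mcoeffZ mcoeff_map_mpoly mcoeffXn -polyC_natr.
by rewrite derivD derivC add0r derivM derivX derivC mulr0 addr0 mul1r hornerC.
Qed.

(** Linearity of the differential, used to split a tensor into single monomials. *)
Lemma deriv_res_line0_sum (I : finType) (c : I -> C)
    (g : I -> 'I_n -> {mpoly C[n]}) :
  (res_line (fun j => \sum_t c t *: g t j))^`().[0] =
  \sum_t c t * (res_line (g t))^`().[0].
Proof.
etransitivity; first exact: deriv_res_line0.
transitivity (\sum_t c t * \sum_v res_partial v *
    (g t (enum_val v).1)@_(bmnm (val (enum_val v).2))); last first.
  by apply: eq_bigr => t _; congr (_ * _); apply/esym/deriv_res_line0.
under [RHS]eq_bigr do rewrite mulr_sumr.
rewrite exchange_big; apply: eq_bigr => v _; rewrite raddf_sum mulr_sumr.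
by apply: eq_bigr => t _; rewrite /= mcoeffZ mulrCA.
Qed.

(** Only the i-th form moves, scaled by [1 + t], so homogeneity and normalization make the resultant
    [(1 + t) ^ (k ^ (n - 1))]. *)
Lemma deriv_res_line_diag (i : 'I_n) :
  (res_line (fun j => if i == j then 'X_j ^+ k else 0))^`().[0] = (k ^ n.-1)%:R.
Proof.
case: PP => _ scaleP _ one.
have -> : res_line (fun j => if i == j then 'X_j ^+ k else 0) =
    (1 + 'X) ^+ (k ^ n.-1).
  apply: closed_poly_eq => t; rewrite horner_res_line !hornerE.
  rewrite -[RHS]mulr1 -[X in _ = _ * X]one -(scaleP _ i); last by move=> j; apply: XnU_homog.
  apply: eq_res_eval => j; rewrite eq_sym; case: eqP => _.
    by rewrite scalerDl scale1r.
  by rewrite scaler0 addr0.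
rewrite deriv_exp derivD derivX derivC add0r mul1r hornerMn !hornerE.
by rewrite expr1n.
Qed.

(* Off the diagonal the forms keep [0] as their only common zero all along the
   line, so that [res_line] has no root, hence is constant. *)
Lemma deriv_res_line_offdiag (i : 'I_n) (s : seq 'I_n) :
  size s = k -> ~~ all (pred1 i) s ->
  (res_line (fun j => if i == j then \prod_(l <- s) 'X_l else 0))^`().[0] = 0.
Proof.
move=> sk /allPn[l ls li]; have k0 : (0 < k)%N by rewrite -sk; case: s ls {sk}.
case: PP => _ _ zeroP _; set p := res_line _.
suff /size_poly1P[c _ ->] : size p == 1%N by rewrite derivC horner0.
apply/negPn/negP => /closed_rootP[t /rootP]; rewrite horner_res_line zeroP.
  case=> x /eqP x0 xP; apply: x0; apply/rowP => j; rewrite mxE.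
  (* All forms but the i-th are pure powers, so a common zero vanishes off [i]. The monomial
     contains ['X_l] with [l != i], hence vanishes too, and the i-th form leaves [x_i ^ k = 0]. *)
  have xj (l' : 'I_n) : l' != i -> x 0 l' = 0.
    move=> l'i; move: (xP l'); rewrite eq_sym (negPf l'i) scaler0 addr0.
    by rewrite rmorphXn /= mevalXU => /eqP; rewrite expf_eq0 k0 => /eqP.
  have [->|/xj//] := eqVneq j i; move: (xP i).
  rewrite eqxx mevalD mevalZ rmorphXn /= mevalXU rmorph_prod /=.
  rewrite (big_rem l) //= mevalXU (xj l li) mul0r mulr0 addr0 => /eqP.
  by rewrite expf_eq0 k0 => /eqP.
move=> j; rewrite rpredD ?XnU_homog //; apply: rpredZ.
case: ifP => _; last exact: rpred0.
rewrite -sk; elim: (s) => [|v r ih] /=; first by rewrite big_nil dhomog1.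
by rewrite big_cons -add1n; apply: dhomogM ih; rewrite dhomogX /= mdeg1.
Qed.

End Resultant.

(** At 0 every factor is 1, so the product rule just adds the slopes [- l]. *)
Lemma deriv_prod_1subX (S : comNzRingType) (s : seq S) :
  (\prod_(l <- s) (1 - l *: 'X))^`().[0] = - \sum_(l <- s) l.
Proof.
elim: s => [|l s ih]; first by rewrite !big_nil derivC horner0 oppr0.
rewrite !big_cons derivM hornerD !hornerM ih derivB derivC derivZ derivX.
rewrite horner_prod big1 => [|y _]; last by rewrite !hornerE ?mulr0 ?subr0.
by rewrite !hornerE ?mulr0 ?subr0 ?mul1r ?mulr1 ?sub0r opprD.
Qed.

(** * Trace and determinant through the characteristic polynomial *)

Section CharPoly.
Variables (R : realType) (k n : nat) (Res : res_poly n k.+1.-1).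
Hypothesis hRes : is_resultant R Res.
Variable A : tensor R k.+1 n.
Local Notation Ac := (fun t => (A t)%:C).

(** The resultant commutes with ring morphisms, here complexification followed by evaluation at
    [z]. *)
Lemma horner_char_poly (z : R[i]) :
  (map_poly (real_complex R) (tensor_char_poly Res A)).[z] =
  res_eval Res (fun j => z *: 'X_j ^+ k - tensor_sys Ac j).
Proof.
pose B : tensor R[i] k.+1 n := fun t => tensor_id _ t * z - (A t)%:C.
transitivity (res_eval Res (tensor_sys B)).
  pose h := horner_eval z \o map_poly (real_complex R).
  apply/esym/(res_eval_morph _ (h := h)) => i a.
  apply: (tensor_sys_morph (h := h)) => t.
  rewrite /h /= /horner_eval rmorphB rmorphM /= map_polyX map_polyC !hornerE /=.
  by rewrite /B /tensor_id rmorph_nat -polyC_natr hornerC.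
apply: eq_res_eval => i; rewrite -[k]/(k.+1.-1) -tensor_sys_id // /tensor_sys scaler_sumr.
rewrite -sumrB; apply: eq_bigr => t _.
by rewrite scalerA -scalerBl [z * _]mulrC.
Qed.

Lemma tensor_det_spectrum (s : seq R) : is_H_spectrum Res A s ->
  \prod_(l <- s) l = tensor_det Res A.
Proof.
case=> szs cp _.
have detC : res_eval Res (tensor_sys Ac) = (tensor_det Res A)%:C.
  apply: (res_eval_morph _ (h := real_complex R)) => i a.
  exact: (tensor_sys_morph (h := real_complex R)).
(* At 0 the value is both the product of the [- l] and the resultant of [-A]; the signs [(-1) ^ d]
   cancel. *)
have := horner_char_poly 0.
have -> : res_eval Res (fun j => 0 *: 'X_j ^+ k - tensor_sys Ac j) =
    res_eval Res (fun j => (-1) *: tensor_sys Ac j).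
  by apply: eq_res_eval => j; rewrite scale0r sub0r scaleN1r.
rewrite (res_scale hRes) => [|j]; last exact: tensor_sys_homog.
rewrite -(rmorph0 (real_complex R)) horner_map /= cp horner_prod detC.
under eq_bigr do rewrite hornerXsubC sub0r -mulN1r.
rewrite big_split /= big_const_seq count_predT iter_mulr_1 szs rmorphM.
rewrite rmorphXn rmorphN1 => /mulfI H; apply: complexI; apply: H.
by rewrite signr_eq0.
Qed.

Lemma tensor_trace_spectrum (s : seq R) : is_H_spectrum Res A s ->
  \sum_(l <- s) l = (k ^ n.-1)%:R * tensor_trace A.
Proof.
case=> szs cp _.
(* [E t] is the single monomial contributed by the entry at [t], placed in the component given by
   the head of [t]. *)
pose E (t : k.+1.-tuple 'I_n) (j : 'I_n) : {mpoly R[i][n]} :=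
  if ohead t == Some j then \prod_(l <- behead t) 'X_l else 0.
pose g j := \sum_t (- (A t)%:C) *: E t j.
have gE j : g j = - tensor_sys Ac j.
  rewrite /g /tensor_sys [in RHS]big_mkcond -sumrN; apply: eq_bigr => t _.
  by rewrite /E; case: ifP => _; rewrite ?scaleNr // scaler0 oppr0.
have lineE : res_line Res g = \prod_(l <- map (real_complex R) s) (1 - l *: 'X).
  (* The factor ['X] makes [z = 0] trivial; otherwise pulling [z] out of every form gives [z ^ d]
     times the characteristic polynomial at [z^-1]. *)
  apply: (mulIf (x := 'X)); first by rewrite polyX_eq0.
  apply: closed_poly_eq => z; rewrite !hornerM hornerX.
  have [->|z0] := eqVneq z 0; first by rewrite !mulr0.
  congr (_ * z); rewrite horner_res_line horner_prod big_map.
  have -> : res_eval Res (fun j => 'X_j ^+ k + z *: g j) =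
      res_eval Res (fun j => z *: (z^-1 *: 'X_j ^+ k - tensor_sys Ac j)).
    apply: eq_res_eval => j; rewrite gE scalerBr scalerA divff // scale1r.
    by rewrite scalerN.
  rewrite (res_scale hRes) => [|j]; last first.
    by rewrite rpredB ?rpredZ ?XnU_homog ?tensor_sys_homog.
  rewrite -horner_char_poly cp rmorph_prod horner_prod -szs.
  rewrite -iter_mulr_1 -count_predT -big_const_seq -big_split.
  apply: eq_bigr => l _ /=.
  by rewrite map_polyXsubC hornerXsubC mulrBr divff // !hornerE mulrC.
(* The slope at 0 is computed twice: from the product over the spectrum and by linearity in the
   entries of [A]. *)
have := deriv_prod_1subX (map (real_complex R) s).
rewrite -lineE deriv_res_line0_sum big_map -rmorph_sum.
have E0 t : (res_line Res (E t))^`().[0] = if constant t then (k ^ n.-1)%:R else 0.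
  case/tupleP: t => i s'; rewrite /E /=.
  transitivity (res_line Res
    (fun j => if i == j then \prod_(l <- s') 'X_l else 0
       : {mpoly R[i][n]}))^`().[0].
    by [].
  have [/all_pred1P sE|sE] := boolP (all (pred1 i) s').
    etransitivity; last exact: (deriv_res_line_diag hRes i).
    apply: (congr1 (fun p : {poly R[i]} => p^`().[0])).
    apply: eq_res_line => j.
    case: eqP => // <-; rewrite sE big_nseq size_tuple.
    by elim: (k) => //= q ->; rewrite exprS.
  by apply: (deriv_res_line_offdiag hRes); rewrite ?size_tuple.
have -> : \sum_t - (A t)%:C * (res_line Res (E t))^`().[0] =
    - (((k ^ n.-1)%:R * \sum_(t : k.+1.-tuple 'I_n | constant t) A t)%:C).
  rewrite rmorphM rmorph_nat rmorph_sum mulr_sumr -sumrN [RHS]big_mkcond.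
  apply: eq_bigr => t _; rewrite E0; case: ifP => _; last by rewrite mulr0.
  by rewrite mulNr mulrC.
move=> /oppr_inj/complexI <-; congr (_ * _).
(* A constant tuple is determined by its head, so the sum over constant tuples is the trace. *)
rewrite (reindex_onto (@nseq_tuple k.+1 'I_n) (@thead _ _)) /=; last first.
  move=> t; case/tupleP: t => i s' /= ; rewrite theadE => /all_pred1P sE.
  by apply: val_inj; rewrite /= [in RHS]sE size_tuple.
apply: eq_bigl => i.
by rewrite -[X in X && _]/(constant (nseq k.+1 i)) constant_nseq /thead (tnth_nth i) eqxx.
Qed.

End CharPoly.

(** * The polynomial [phi] and the feasibility region *)

Lemma mup_deriv (R : numFieldType) (p : {poly R}) (x : R) :
  p^`() != 0 -> root p x -> mup x p = (mup x p^`()).+1.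
Proof.
move=> dp0 px; have p0 : p != 0 by apply: contraNneq dp0 => ->; rewrite deriv0.
have [n [q nqx pE]] := multiplicity_XsubC p x; move: nqx; rewrite p0 /= => nqx.
case: n pE => [|n] pE; first by rewrite pE mulr1 (negPf nqx) in px.
have dpE : p^`() = (q^`() * ('X - x%:P) + q *+ n.+1) * ('X - x%:P) ^+ n.
  rewrite pE derivM deriv_exp derivXsubC mul1r /= exprS [RHS]mulrDl mulrA.
  by rewrite mulrnAr mulrnAl.
rewrite {1}pE dpE !mupMr ?mup_XsubCX ?eqxx // /root !hornerE hornerMn subrr.
by rewrite mulr0 add0r mulrn_eq0 /= -[_ == 0]/(root q x).
Qed.

Lemma prodr_le_mean (R : realFieldType) (s : seq R) :
  {in s, forall l, 0 <= l} ->
  \prod_(l <- s) l <= ((\sum_(l <- s) l) / (size s)%:R) ^+ size s.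
Proof.
move=> s0; rewrite !(big_nth (0 : R)) !big_mkord.
have := leif_AGM (A := {: 'I_(size s)}) (E := fun i => s`_i).
rewrite /= cardT size_enum_ord => H; apply: (H _).1.
by move=> i _; apply/s0/mem_nth.
Qed.

(** * Roots of [phi] and their multiplicities *)

Section Phi.
Variables (R : realType) (e : nat).
Implicit Types T D x : R.
(** This form encodes [d >= 2] and makes [d.-1] compute to [e.+1]. *)
Local Notation d := e.+2.

Lemma horner_phi T D x :
  (phi d T D).[x] = x * (T - x) ^+ e.+1 - D * e.+1%:R ^+ e.+1.
Proof. by rewrite /phi !hornerE. Qed.

Lemma deriv_phi T D :
  (phi d T D)^`() = (T%:P - 'X) ^+ e * (T%:P - d%:R *: 'X).
Proof.
rewrite /phi derivB derivC subr0 derivM derivX deriv_exp derivB derivC derivX.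
rewrite /= scaler_nat mul1r sub0r mulN1r mulNrn mulrN [_ *+ d]mulrS opprD addrA.
by rewrite exprSr [RHS]mulrBr !mulrnAr ['X * _]mulrC.
Qed.

(** Away from [T] only the linear factor can vanish, simply and at [T / d]; the boolean is read as 0
    or 1. *)
Lemma mup_deriv_phi T D x :
  x != T -> mup x (phi d T D)^`() = (x == T / d%:R) :> nat.
Proof.
move=> xT; rewrite deriv_phi mupMr; last first.
  by rewrite /root !hornerE expf_neq0 // subr_eq0 eq_sym.
have dn0 : d%:R != 0 :> R by rewrite pnatr_eq0.
have -> : T%:P - d%:R *: 'X = (- d%:R)%:P * ('X - (T / d%:R)%:P) ^+ 1.
  rewrite expr1 mulrBr -polyCM mul_polyC scaleNr mulNr [_ * (T / _)]mulrC.
  by rewrite divfK // polyCN opprK addrC.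
rewrite mupMr ?mup_XsubCX 1?eq_sym; first by case: eqP.
by rewrite rootC oppr_eq0.
Qed.

Lemma mup_phi T D x : 0 < T -> x != T -> root (phi d T D) x ->
  mup x (phi d T D) = (x == T / d%:R).+1.
Proof.
move=> T0 xT px; rewrite mup_deriv ?mup_deriv_phi //.
(* The derivative is nonzero, since its value at 0 is [T ^ (d - 1)]. *)
apply/eqP => /(congr1 (horner^~ 0)); rewrite deriv_phi !hornerE ?mulr0 ?subr0.
by apply/eqP; rewrite mulf_neq0 ?expf_neq0 // gt_eqF.
Qed.

(** Rolle gives a critical point strictly between the roots; being below [T], it can only be
    [T / d]. *)
Lemma phi_roots_separated T D x y : x < y < T ->
  root (phi d T D) x -> root (phi d T D) y -> x < T / d%:R < y.
Proof.
case/andP=> xy yT /rootP px /rootP py.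
have [|z] := poly_rolle (p := phi d T D) xy; first by rewrite px py.
rewrite in_itv /= => /andP[xz zy] /eqP.
rewrite deriv_phi !hornerE mulf_eq0 expf_eq0 subr_eq0.
rewrite [T == z]gt_eqF ?(lt_trans zy) // andbF /= subr_eq0 => /eqP ->.
by rewrite [d%:R * z]mulrC mulfK ?pnatr_eq0 // xz zy.
Qed.

(** The sign of [phi] at the mean is thus that of the AM-GM gap. *)
Lemma phi_mean T D :
  (phi d T D).[T / d%:R] = e.+1%:R ^+ e.+1 * ((T / d%:R) ^+ d - D).
Proof.
rewrite horner_phi mulrBr [D * _]mulrC; congr (_ - _).
have -> : T - T / d%:R = e.+1%:R * (T / d%:R).
  rewrite -[X in X - _](divfK (x := d%:R)) ?pnatr_eq0 //.
  by rewrite [X in _ * X - _]mulrS mulrDr mulr1 addrC addrA addNr add0r mulrC.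
by rewrite exprMn exprS mulrCA.
Qed.

(** * Feasible points and the sign of [phi] *)

Lemma feasible_phi_ge0 T D s x :
  feasible2 d T D s -> x \in s -> 0 < x < T /\ 0 <= (phi d T D).[x].
Proof.
case=> szs s0 sT sD xs; have sP := perm_to_rem xs.
have r0 : {in rem x s, forall l, 0 < l} by move=> l /mem_rem/s0.
have szr : size (rem x s) = e.+1 by rewrite size_rem // szs.
move: sT sD; rewrite !(perm_big _ sP) !big_cons => <- <-.
(* AM-GM on the [d - 1] remaining coordinates, of sum [T - x]; multiplying by [x] will restore the
   product [D]. *)
have := prodr_le_mean (s := rem x s) (fun l lr => ltW (r0 l lr)).
rewrite szr horner_phi expr_div_n ler_pdivlMr ?exprn_gt0 ?ltr0n // => H.
have sr0 : 0 < \sum_(l <- rem x s) l.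
  case: (rem x s) szr r0 => //= y r _ r0.
  rewrite big_cons ltr_pwDl ?r0 ?mem_head // big_seq sumr_ge0 // => l lr.
  by rewrite ltW ?r0 // inE lr orbT.
rewrite s0 //= ltrDl sr0; split=> //.
rewrite subr_ge0 -mulrA [x + _]addrC addrK.
by rewrite ler_wpM2l // ltW ?s0.
Qed.

Lemma feasible_le_mean T D s : feasible2 d T D s -> D <= (T / d%:R) ^+ d.
Proof.
case=> szs s0 <- <-; rewrite -szs; apply: prodr_le_mean => l /s0; exact: ltW.
Qed.

(** Equality case of AM-GM: with [c = (T - x) / (d - 1)], a root of [phi] satisfies
    [x c ^ (d - 1) = D]. *)
Lemma feasible_nseq T D x :
  0 < x < T -> root (phi d T D) x ->
  feasible2 d T D (x :: nseq e.+1 ((T - x) / e.+1%:R)).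
Proof.
case/andP=> x0 xT /rootP; rewrite horner_phi => /eqP; rewrite subr_eq0 => /eqP px.
have e0 : 0 < e.+1%:R :> R by rewrite ltr0n.
split=> [|l||].
- by rewrite /= size_nseq.
- by rewrite inE mem_nseq => /predU1P[-> //|/eqP->]; rewrite divr_gt0 ?subr_gt0.
- rewrite big_cons big_nseq iter_addr_0 -[_ / _ *+ _]mulr_natr divfK ?gt_eqF //; ring.
- rewrite big_cons big_nseq iter_mulr_1 expr_div_n mulrA px mulfK //.
  by rewrite expf_neq0 ?gt_eqF.
Qed.

Lemma feasible_perm T D s t : perm_eq s t -> feasible2 d T D s -> feasible2 d T D t.
Proof.
move=> st [szs s0 sT sD]; split; rewrite -?(perm_big _ st) -?(perm_size st) //.
by move=> l; rewrite -(perm_mem st); apply: s0.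
Qed.

(** * Location of the roots and extremal coordinates *)

Lemma phi_dichotomy T D lam : feasible2 d T D lam ->
  [/\ D = (T / d%:R) ^+ d,
      0 < T / d%:R < T,
      mup (T / d%:R) (phi d T D) = 2%N
    & forall x, 0 < x < T -> root (phi d T D) x -> x = T / d%:R ]
  \/
  D <> (T / d%:R) ^+ d /\
  exists Lm Lp : R,
    [/\ [/\ 0 < Lm, Lm < T / d%:R, T / d%:R < Lp & Lp < T],
        [/\ mup Lm (phi d T D) = 1%N,
            mup Lp (phi d T D) = 1%N
          & forall x, 0 < x < T -> root (phi d T D) x -> x = Lm \/ x = Lp],
        is_B2plus d T D Lp /\ is_B2minus d T D Lm,
        head 0 lam <= Lp /\ Lm <= last 0 lam
      & let c := (T - Lp) / e.+1%:R in
        let c' := (T - Lm) / e.+1%:R in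
        feasible2 d T D (Lp :: nseq e.+1 c) /\
        feasible2 d T D (rcons (nseq e.+1 c') Lm) ].
Proof.
move=> flam.
have head_in s : feasible2 d T D s -> head 0 s \in s.
  by case: s => [|y s] [] //= *; rewrite mem_head.
have last_in s : feasible2 d T D s -> last 0 s \in s.
  by case: s => [|y s] [] //= *; rewrite mem_last.
have [/andP[h0 hT] _] := feasible_phi_ge0 flam (head_in _ flam).
have T0 : 0 < T by apply: lt_trans hT.
have D0 : 0 < D.
  by case: flam => _ l0 _ <-; rewrite big_seq prodr_gt0.
have M0 : 0 < T / d%:R by rewrite divr_gt0 ?ltr0n.
have MT : T / d%:R < T by rewrite ltr_pdivrMr ?ltr0n // ltr_pMr // ltr1n.
have eX : 0 < e.+1%:R ^+ e.+1 :> R by rewrite exprn_gt0 ?ltr0n.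
have p0 : (phi d T D).[0] < 0 by rewrite horner_phi mul0r sub0r oppr_lt0 mulr_gt0.
have pT : (phi d T D).[T] < 0.
  by rewrite horner_phi subrr expr0n mulr0 sub0r oppr_lt0 mulr_gt0.
have [DE|/eqP DE] := eqVneq D ((T / d%:R) ^+ d); [left|right].
  have rM : root (phi d T D) (T / d%:R).
    by apply/rootP; rewrite phi_mean -DE subrr mulr0.
  split=> //; first by rewrite M0 MT.
    by rewrite mup_phi ?eqxx ?lt_eqF.
  move=> x /andP[x0 xT] px; case: (ltgtP x (T / d%:R)) => // xM.
    (* A second root would put [T / d] strictly between itself and [T / d]. *)
    have := @phi_roots_separated T D x _ _ px rM.
    by rewrite xM MT ltxx andbF => /(_ isT).
  by have := @phi_roots_separated T D _ x _ rM px; rewrite xM xT ltxx => /(_ isT).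
split=> //.
have pM : 0 < (phi d T D).[T / d%:R].
  rewrite phi_mean mulr_gt0 // subr_gt0 lt_neqAle (feasible_le_mean flam) andbT.
  exact/eqP.
(* [phi] is negative at 0 and [T] and positive at [T / d], so it has a root on each side. *)
have [|Lm] := poly_ivtoo (p := phi d T D) (ltW M0); first by rewrite nmulr_rlt0.
rewrite in_itv /= => /andP[m0 mM] rm.
have [|Lp] := poly_ivtoo (p := phi d T D) (ltW MT); first by rewrite pmulr_rlt0.
rewrite in_itv /= => /andP[Mp pltT] rp.
have mT := lt_trans mM MT; have Lp0 := lt_trans M0 Mp.
have roots x : 0 < x < T -> root (phi d T D) x -> x = Lm \/ x = Lp.
  case/andP=> x0 xT px; case: (ltgtP x (T / d%:R)) => xM.
  - left; case: (ltgtP x Lm) => // xL.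
      have := @phi_roots_separated T D x Lm _ px rm; rewrite xL mT => /(_ isT).
      by rewrite [_ < Lm]ltNge (ltW mM) andbF.
    have := @phi_roots_separated T D Lm x _ rm px; rewrite xL xT => /(_ isT).
    by rewrite [_ < x]ltNge (ltW xM) andbF.
  - right; case: (ltgtP x Lp) => // xL.
      have := @phi_roots_separated T D x Lp _ px rp; rewrite xL pltT => /(_ isT).
      by rewrite [x < _]ltNge (ltW xM).
    have := @phi_roots_separated T D Lp x _ rp px; rewrite xL xT => /(_ isT).
    by rewrite [Lp < _]ltNge (ltW Mp).
  - by move/rootP: px pM; rewrite xM => ->; rewrite ltxx.
(* A feasible coordinate outside [[Lm, Lp]] has [phi >= 0], so a sign change between it and the
   nearer of 0 and [T] yields a third root. *)
have bounds s x : feasible2 d T D s -> x \in s -> Lm <= x <= Lp.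
  move=> fs xs; have [/andP[x0 xT] px] := feasible_phi_ge0 fs xs.
  apply/andP; split; rewrite leNgt; apply/negP => xL.
    have [|z] := polyrcf.poly_ivt (p := phi d T D) (ltW x0); first by rewrite nmulr_rle0.
    rewrite in_itv /= => /andP[z0 zx] rz; have zm := le_lt_trans zx xL.
    (* The closed intermediate value theorem allows [z = 0], excluded by [phi(0) < 0]. *)
    have z0' : 0 < z.
      by rewrite lt_neqAle z0 andbT; apply: contraTneq rz => <-; rewrite /root lt_eqF.
    have [|zE|zE] := roots z _ rz; first by rewrite z0' (lt_trans zm).
      by rewrite zE ltxx in zm.
    by move: zm; rewrite zE ltNge (ltW (lt_trans mM Mp)).
  have [|z] := polyrcf.poly_ivt (p := phi d T D) (ltW xT); first by rewrite nmulr_lle0.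
  rewrite in_itv /= => /andP[xz zT] rz; have zp := lt_le_trans xL xz.
  have zT' : z < T.
    by rewrite lt_neqAle zT andbT; apply: contraTneq rz => ->; rewrite /root lt_eqF.
  have [|zE|zE] := roots z _ rz; first by rewrite zT' (lt_trans Lp0 zp).
    by move: zp; rewrite zE ltNge (ltW (lt_trans mM Mp)).
  by rewrite zE ltxx in zp.
have fp : feasible2 d T D (Lp :: nseq e.+1 ((T - Lp) / e.+1%:R)).
  by apply: feasible_nseq; rewrite ?Lp0.
have fm : feasible2 d T D (rcons (nseq e.+1 ((T - Lm) / e.+1%:R)) Lm).
  apply: (@feasible_perm _ _ (Lm :: nseq e.+1 ((T - Lm) / e.+1%:R))).
    by rewrite perm_sym perm_rcons.
  by apply: feasible_nseq; rewrite ?m0.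
exists Lm, Lp; split=> //.
- split=> //; first by rewrite mup_phi ?(lt_eqF mT) // (lt_eqF mM).
  by rewrite mup_phi ?(lt_eqF pltT) // (gt_eqF Mp).
- split; split.
  + by eexists; first exact: fp.
  + by move=> s fs; case/andP: (bounds s _ fs (head_in s fs)).
  + by eexists; [exact: fm | rewrite last_rcons].
  + by move=> s fs; case/andP: (bounds s _ fs (last_in s fs)).
- by case/andP: (bounds _ _ flam (head_in _ flam)); case/andP: (bounds _ _ flam (last_in _ flam)).
Qed.

End Phi.

Theorem theorem3p1 (R : realType) (m n d : nat)
    (Res : res_poly n m.-1) (hRes : is_resultant R Res)
    (A : tensor R m n) (hsym : tensor_symmetric A) (hpos : tensor_posdef A)
    (hd : d = (n * m.-1 ^ n.-1)%N) (hd2 : (2 <= d)%N)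
    (lam : seq R) (hlam : is_H_spectrum Res A lam)
    (hlam0 : {in lam, forall l, 0 < l})
    (T D : R) (hT : T = \sum_(l <- lam) l) (hD : D = \prod_(l <- lam) l) :
  [/\ T = (m.-1 ^ n.-1)%:R * tensor_trace A,
      D = tensor_det Res A
    & (* a unique double root *)
      [/\ D = (T / d%:R) ^+ d,
          0 < T / d%:R < T,
          mup (T / d%:R) (phi d T D) = 2%N
        & forall x, 0 < x < T -> root (phi d T D) x -> x = T / d%:R ]
      \/
      (* exactly two simple roots *)
      D <> (T / d%:R) ^+ d /\
      exists Lm Lp : R,
        [/\ [/\ 0 < Lm, Lm < T / d%:R, T / d%:R < Lp & Lp < T],
            [/\ mup Lm (phi d T D) = 1%N,
                mup Lp (phi d T D) = 1%N
              & forall x, 0 < x < T -> root (phi d T D) x -> x = Lm \/ x = Lp],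
            is_B2plus d T D Lp /\ is_B2minus d T D Lm,
            head 0 lam <= Lp /\ Lm <= last 0 lam
          & let c := (T - Lp) / d.-1%:R in
            let c' := (T - Lm) / d.-1%:R in
            feasible2 d T D (Lp :: nseq d.-1 c) /\
            feasible2 d T D (rcons (nseq d.-1 c') Lm) ] ].
Proof.
have n0 : (0 < n)%N by rewrite lt0n; apply: contraTneq hd2 => n0; rewrite hd n0.
(* For [m = 0] the truncated [m.-1] is 0, and [n * 0 ^ n.-1] is at most 1, attained at [n = 1]. *)
have m0 : (0 < m)%N.
  rewrite lt0n; apply: contraTneq hd2 => m0; rewrite hd m0 -leqNgt.
  by case: (n) n0 => [|[|n']] // _; rewrite exp0n ?muln0.
case: m m0 Res hRes A hsym hpos hd hlam => // k _ Res' hRes' A' _ _ hd hlam.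
split; first by rewrite hT; apply: (tensor_trace_spectrum hRes' hlam).
  by rewrite hD; apply: (tensor_det_spectrum hRes' hlam).
have flam : feasible2 d T D lam by split=> //; rewrite hd; case: hlam.
case: d hd2 flam {hd} => [|[|e]] // _ flam; exact: phi_dichotomy flam.
Qed.
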